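(* Let $f,g:\mathbb{R}^n\to(-\infty,+\infty]$ be proper, lower semicontinuous and prox-bounded with thresholds $\lambda_f,\lambda_g>0$, let $0<\mu<\bar\lambda=\min\{\lambda_f,\lambda_g\}$, $\alpha\in(0,1)$, and let $\varphi^{\alpha}_{\mu}=-e_{\mu}(-\alpha e_{\mu}f-(1-\alpha)e_{\mu}g)$. Let $x\in\operatorname{dom}\varphi^{\alpha}_{\mu}$ and $x=y+z$. Suppose the following conditions hold: (a) $$\left[\alpha\operatorname{conv}\Big(f+\tfrac{1}{2\mu}\|\cdot\|^2\Big)\Big(\tfrac{\cdot}{\alpha}\Big)\Box(1-\alpha)\operatorname{conv}\Big(g+\tfrac{1}{2\mu}\|\cdot\|^2\Big)\Big(\tfrac{\cdot}{1-\alpha}\Big)\right](x)=\alpha\operatorname{conv}\Big(f+\tfrac{1}{2\mu}\|\cdot\|^2\Big)\Big(\tfrac{y}{\alpha}\Big)+(1-\alpha)\operatorname{conv}\Big(g+\tfrac{1}{2\mu}\|\cdot\|^2\Big)\Big(\tfrac{z}{1-\alpha}\Big);$$ (b) $\{y_1,\ldots,y_l\}$ are called by $y/\alpha$ in $\operatorname{conv}(f+\frac{1}{2\mu}\|\cdot\|^2)$; (c) $\{z_1,\ldots,z_m\}$ are called by $z/(1-\alpha)$ in $\operatorname{conv}(g+\frac{1}{2\mu}\|\cdot\|^2)$. Then $$\hat\partial\varphi^{\alpha}_{\mu}(x)=\partial_L\varphi^{\alpha}_{\mu}(x)=\partial_C\varphi^{\alpha}_{\mu}(x)=\left[\bigc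ap_{i=1}^{l}\partial\Big(f+\tfrac{1}{2\mu}\|\cdot\|^2\Big)(y_i)\right]\cap\left[\bigcap_{j=1}^{m}\partial\Big(g+\tfrac{1}{2\mu}\|\cdot\|^2\Big)(z_j)\right]-\frac{x}{\mu}.$$
   Context: $\|\cdot\|$ is the Euclidean norm. $e_{\mu}f(x)=\inf_{w}\{f(w)+\frac{1}{2\mu}\|w-x\|^2\}$. $f$ is prox-bounded if there exist $\lambda>0$ and $x$ with $e_{\lambda}f(x)>-\infty$; the supremum of all such $\lambda$ is its threshold $\lambda_f\in(0,+\infty]$. $\operatorname{conv}h$ is the convex hull of the function $h$ (largest convex function below $h$); $\alpha h(\frac{\cdot}{\alpha})$ is $x\mapsto\alpha h(x/\alpha)$; $f_1\Box f_2(x)=\inf_w\{f_1(x-w)+f_2(w)\}$. A finite family $\{x_1,\ldots,x_m\}\subset\operatorname{dom}h$ is called by $x\in\operatorname{dom}\operatorname{conv}h$ (in $\operatorname{conv}h$) if there are $\alpha_i>0$ with $\sum_{i=1}^m\alpha_i=1$, $x=\sum_{i=1}^{m}\alpha_ix_i$ and $\operatorname{conv}h(x)=\sum_{i=1}^{m}\alpha_ih(x_i)$. Subdifferentials at $x\in\operatorname{dom}h$: Fenchel, $\partial h(x)=\{s:h(y)\ge h(x)+\langle s,y-x\rangle\ \forall y\in\mathbb{R}^n\}$ (used also for nonconvex $h$, possibly empty); Fréchet, $\hat\partial h(x)=\{s:h(y)\ge h(x)+\langle s,y-x\rangle+o(\|y-x\|)\}$; limiting, $\partial_Lh(x)=\{v:\exists\,x_k\to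 x,\ h(x_k)\to h(x),\ s_k\in\hat\partial h(x_k),\ s_k\to v\}$; Clarke, $\partial_Ch(x)=\operatorname{conv}\partial_Lh(x)$ when $h$ is locally Lipschitz at $x$, and in general $\partial_Ch(x)=\{v:(v,-1)\in N^C_{\operatorname{epi}h}(x,h(x))\}$ with $N^C$ the Clarke normal cone (closed convex hull of the limiting normal cone). *)

(* Defs.v *)
From HB Require Import structures.
From mathcomp Require Import all_boot all_order all_algebra.
From mathcomp Require Import all_classical all_reals all_analysis.
Set Implicit Arguments.
Unset Strict Implicit.
Unset Printing Implicit Defensive.
Import Order.TTheory GRing.Theory Num.Theory.
Import numFieldNormedType.Exports.
Local Open Scope classical_set_scope.
Local Open Scope ring_scope.

(* The library norm `|x| of 'rV[R]_n is the sup norm, so the Euclidean norm is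
   defined here; both induce the same (product) topology, hence limits,
   neighbourhoods, closures and lower semicontinuity are the library's. *)
Definition dot (R : realType) (n : nat) (u v : 'rV[R]_n) : R :=
  \sum_(i < n) u ord0 i * v ord0 i.

Definition enorm (R : realType) (n : nat) (u : 'rV[R]_n) : R :=
  Num.sqrt (dot u u).

Definition efun_dom (R : realType) (n : nat) (h : 'rV[R]_n -> \bar R) :
  set 'rV[R]_n := [set x | (h x < +oo)%E].

Definition efun_proper (R : realType) (n : nat) (h : 'rV[R]_n -> \bar R) : Prop :=
  (forall x, (-oo < h x)%E) /\ efun_dom h !=set0.

Definition moreau_env (R : realType) (n : nat) (mu : R)
    (h : 'rV[R]_n -> \bar R) (x : 'rV[R]_n) : \bar R :=
  ereal_inf [set (h w + ((2 * mu)^-1 * enorm (w - x) ^+ 2)%:E)%E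
            | w in [set: 'rV[R]_n]].

Definition prox_params (R : realType) (n : nat) (h : 'rV[R]_n -> \bar R) :
  set R := [set l | 0 < l /\ exists x, (-oo < moreau_env l h x)%E].

Definition prox_bounded (R : realType) (n : nat) (h : 'rV[R]_n -> \bar R) :
  Prop := prox_params h !=set0.

Definition prox_threshold (R : realType) (n : nat) (h : 'rV[R]_n -> \bar R) :
  \bar R := ereal_sup [set l%:E | l in prox_params h].

(* The point (x, r) of R^n x R is encoded as row_mx x r%:M in R^(n+1). *)
Definition epi (R : realType) (n : nat) (h : 'rV[R]_n -> \bar R) :
  set 'rV[R]_(n + 1) :=
  [set row_mx q.1 q.2%:M | q in [set q : 'rV[R]_n * R | (h q.1 <= q.2%:E)%E]].

Definition efun_convex (R : realType) (n : nat) (h : 'rV[R]_n -> \bar R) :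
  Prop := convex_set (epi h).

(* A pointwise supremum of convex functions is convex, so this is the largest
   convex function below h: see conv_fun_le, conv_fun_max, conv_fun_convex. *)
Definition conv_fun (R : realType) (n : nat) (h : 'rV[R]_n -> \bar R)
    (x : 'rV[R]_n) : \bar R :=
  ereal_sup [set k x | k in [set k : 'rV[R]_n -> \bar R |
                             efun_convex k /\ forall y, (k y <= h y)%E]].

Lemma conv_fun_le (R : realType) (n : nat) (h : 'rV[R]_n -> \bar R)
    (x : 'rV[R]_n) : (conv_fun h x <= h x)%E.
Proof. by apply: ge_ereal_sup => _ [k [_ kh] <-]. Qed.

Lemma conv_fun_max (R : realType) (n : nat) (h k : 'rV[R]_n -> \bar R) :
  efun_convex k -> (forall y, (k y <= h y)%E) ->
  forall x, (k x <= conv_fun h x)%E.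
Proof. by move=> ck kh x; apply: ereal_sup_ubound; exists k. Qed.

Lemma epiE (R : realType) (n : nat) (h : 'rV[R]_n -> \bar R)
    (x : 'rV[R]_n) (r : R) :
  epi h (row_mx x r%:M) <-> (h x <= r%:E)%E.
Proof.
split=> [[[a b] /= hab /eq_row_mx[<-]]|hx]; last by exists (x, r).
by move=> /matrixP /(_ ord0 ord0); rewrite !mxE eqxx !mulr1n => <-.
Qed.

Lemma conv_fun_convex (R : realType) (n : nat) (h : 'rV[R]_n -> \bar R) :
  efun_convex (conv_fun h).
Proof.
move=> p q t; rewrite !inE => -[[x a] /= xa <-] [[y b] /= yb <-].
have avgE : t%:num *: row_mx x a%:M + (1 - t%:num) *: row_mx y b%:M =
    row_mx (t%:num *: x + (1 - t%:num) *: y) (t%:num * a + (1 - t%:num) * b)%:M :> 'rV_(n + 1).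
  by rewrite !scale_row_mx add_row_mx !scale_scalar_mx -raddfD.
rewrite [X in epi _ X]avgE; apply/epiE; apply: ge_ereal_sup => _ [k kP <-].
have [ck _] := kP.
have := ck (row_mx x a%:M) (row_mx y b%:M) t; rewrite !inE => H.
apply/epiE; rewrite -[X in epi _ X]avgE; apply: H; apply/epiE.
- by apply: le_trans xa; apply: ereal_sup_ubound; exists k.
- by apply: le_trans yb; apply: ereal_sup_ubound; exists k.
Qed.

Definition epi_scale (R : realType) (n : nat) (a : R)
    (h : 'rV[R]_n -> \bar R) (x : 'rV[R]_n) : \bar R :=
  (a%:E * h (a^-1 *: x))%E.

Definition inf_conv (R : realType) (n : nat) (h1 h2 : 'rV[R]_n -> \bar R)
    (x : 'rV[R]_n) : \bar R :=
  ereal_inf [set (h1 (x - w)%R + h2 w)%E | w in [set: 'rV[R]_n]].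

Definition add_quad (R : realType) (n : nat) (mu : R)
    (h : 'rV[R]_n -> \bar R) (x : 'rV[R]_n) : \bar R :=
  (h x + ((2 * mu)^-1 * enorm x ^+ 2)%:E)%E.

Definition called_by (R : realType) (n : nat) (h : 'rV[R]_n -> \bar R)
    (x : 'rV[R]_n) (m : nat) (xs : 'I_m -> 'rV[R]_n) : Prop :=
  [/\ efun_dom (conv_fun h) x,
      forall i, efun_dom h (xs i) &
      exists a : 'I_m -> R,
        [/\ forall i, 0 < a i,
            \sum_(i < m) a i = 1,
            x = \sum_(i < m) a i *: xs i &
            conv_fun h x = (\sum_(i < m) (a i)%:E * h (xs i))%E]].

Definition prox_avg (R : realType) (n : nat) (mu alpha : R)
    (f g : 'rV[R]_n -> \bar R) (x : 'rV[R]_n) : \bar R :=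
  (- moreau_env mu (fun u => - (alpha%:E * moreau_env mu f u)
                             - (1 - alpha)%:E * moreau_env mu g u) x)%E.

Definition fenchel_subdiff (R : realType) (n : nat)
    (h : 'rV[R]_n -> \bar R) (x : 'rV[R]_n) : set 'rV[R]_n :=
  [set s | efun_dom h x /\ forall y, (h x + (dot s (y - x))%:E <= h y)%E].

Definition frechet_subdiff (R : realType) (n : nat)
    (h : 'rV[R]_n -> \bar R) (x : 'rV[R]_n) : set 'rV[R]_n :=
  [set s | efun_dom h x /\ forall e : R, 0 < e -> \forall y \near x,
     (h x + (dot s (y - x) - e * enorm (y - x))%:E <= h y)%E].

Definition limiting_subdiff (R : realType) (n : nat)
    (h : 'rV[R]_n -> \bar R) (x : 'rV[R]_n) : set 'rV[R]_n :=
  [set v | efun_dom h x /\ exists (xk sk : nat -> 'rV[R]_n),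
     [/\ xk @ \oo --> x, h (xk k) @[k --> \oo] --> h x,
         forall k, frechet_subdiff h (xk k) (sk k) & sk @ \oo --> v]].

Definition frechet_normal (R : realType) (n : nat) (C : set 'rV[R]_n)
    (x : 'rV[R]_n) : set 'rV[R]_n :=
  [set v | C x /\ forall e : R, 0 < e -> \forall y \near x,
     C y -> dot v (y - x) <= e * enorm (y - x)].

Definition limiting_normal (R : realType) (n : nat) (C : set 'rV[R]_n)
    (x : 'rV[R]_n) : set 'rV[R]_n :=
  [set v | C x /\ exists (xk vk : nat -> 'rV[R]_n),
     [/\ xk @ \oo --> x, forall k, frechet_normal C (xk k) (vk k) &
         vk @ \oo --> v]].

Definition convex_hull (R : realType) (n : nat) (A : set 'rV[R]_n) :
  set 'rV[R]_n := smallest (@convex_set R 'rV[R]_n) A.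

Definition clarke_normal (R : realType) (n : nat) (C : set 'rV[R]_n)
    (x : 'rV[R]_n) : set 'rV[R]_n :=
  closure (convex_hull (limiting_normal C x)).

(* The general (epigraphical) definition, valid without local Lipschitz
   continuity.  fine (h x) is the real value of h x, which is meaningful since
   the functions considered never take the value -oo. *)
Definition clarke_subdiff (R : realType) (n : nat)
    (h : 'rV[R]_n -> \bar R) (x : 'rV[R]_n) : set 'rV[R]_n :=
  [set v | efun_dom h x /\
     clarke_normal (epi h) (row_mx x (fine (h x))%:M) (row_mx v (-1)%:M)].

(* Main.v *)
Require Import Defs.
From HB Require Import structures.
From mathcomp Require Import all_boot all_order all_algebra.
From mathcomp Require Import all_classical all_reals all_analysis.
From mathcomp Require Import ring lra.
Set Implicit Arguments.
Unset Strict Implicit.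
Unset Printing Implicit Defensive.
Import Order.TTheory GRing.Theory Num.Theory.
Import numFieldNormedType.Exports.
Local Open Scope classical_set_scope.
Local Open Scope ring_scope.

(* Write F = f + |.|^2/(2 mu), G = g + |.|^2/(2 mu), with conjugates F*, G*,
   finite everywhere because mu is below both thresholds.  Then
   phi = Phi - |.|^2/(2 mu) with Phi = (alpha F* + (1 - alpha) G* )* convex, so
   the Frechet, limiting and Clarke subdifferentials of phi at x are all
   equal to the Fenchel subdifferential of Phi at x minus x/mu.  If s is a
   Fenchel subgradient of Phi at x, then s minimizes
   alpha F* + (1 - alpha) G* - <., x>, and a Danskin-type argument puts x in
   the convex hull (compact by Caratheodory) of
   alpha argmax(<s, .> - F) + (1 - alpha) argmax(<s, .> - G).  This bounds
   the infimal convolution at x by Phi x, so Fenchel-Young is an equality at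
   every point called, that is, s is a subgradient of F at each y_i and of G at
   each z_j; the converse is weak duality. *)

(** * Inner product and convexity *)

Section euclidean.
Context {R : realType} {n : nat}.
Implicit Types (u v w : 'rV[R]_n) (a : R).

Lemma dotC u v : dot u v = dot v u.
Proof. by apply: eq_bigr => i _; rewrite mulrC. Qed.

Lemma dotDl u v w : dot (u + v) w = dot u w + dot v w.
Proof. by rewrite -big_split; apply: eq_bigr => i _; rewrite mxE mulrDl. Qed.

Lemma dotZl a u v : dot (a *: u) v = a * dot u v.
Proof. by rewrite mulr_sumr; apply: eq_bigr => i _; rewrite mxE mulrA. Qed.

Lemma dotDr u v w : dot u (v + w) = dot u v + dot u w.
Proof. by rewrite !(dotC u) dotDl. Qed.

Lemma dotZr a u v : dot u (a *: v) = a * dot u v.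
Proof. by rewrite !(dotC u) dotZl. Qed.

Lemma dotNl u v : dot (- u) v = - dot u v.
Proof. by rewrite -scaleN1r dotZl mulN1r. Qed.

Lemma dotNr u v : dot u (- v) = - dot u v.
Proof. by rewrite dotC dotNl dotC. Qed.

Lemma dot0l u : dot 0 u = 0.
Proof. by rewrite -(scale0r u) dotZl mul0r. Qed.

Lemma dot0r u : dot u 0 = 0.
Proof. by rewrite dotC dot0l. Qed.

Lemma dot_sumr (I : finType) (x : I -> 'rV[R]_n) u :
  dot u (\sum_i x i) = \sum_i dot u (x i).
Proof. by apply: (big_morph (dot u)) => [v w|]; rewrite ?dotDr ?dot0r. Qed.

Lemma dot_sqrDZ u v a :
  dot (u + a *: v) (u + a *: v) = dot u u + 2 * a * dot u v + a ^+ 2 * dot v v.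
Proof. by rewrite !(dotDl, dotDr, dotZl, dotZr) (dotC v u); ring. Qed.

Lemma dot_ge0 u : 0 <= dot u u.
Proof. by apply: sumr_ge0 => i _; rewrite -expr2 sqr_ge0. Qed.

Lemma dot_gt0 u : u != 0 -> 0 < dot u u.
Proof.
move=> u0; rewrite lt_neqAle dot_ge0 andbT eq_sym; apply: contra u0 => /eqP u0.
apply/eqP/rowP => i; rewrite mxE; apply/eqP; rewrite -sqrf_eq0 expr2.
by rewrite (psumr_eq0P _ u0) // => j _; rewrite -expr2 sqr_ge0.
Qed.

Lemma enorm_ge0 u : 0 <= enorm u.
Proof. exact: sqrtr_ge0. Qed.

Lemma enormE u : enorm u ^+ 2 = dot u u.
Proof. by rewrite sqr_sqrtr ?dot_ge0. Qed.

Lemma enormZ a u : 0 <= a -> enorm (a *: u) = a * enorm u.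
Proof.
move=> a0; rewrite /enorm dotZl dotZr mulrA -expr2 sqrtrM ?sqr_ge0 //.
by rewrite sqrtr_sqr ger0_norm.
Qed.

Lemma normr_coord (u : 'rV[R]_n) i : `|u ord0 i| <= `|u|.
Proof. by rewrite [leRHS]mx_normrE; apply/bigmax_geP; right; exists (ord0, i). Qed.

Lemma ler_mx_norm_coord (u : 'rV[R]_n) a :
  0 <= a -> (forall i, `|u ord0 i| <= a) -> `|u| <= a.
Proof.
move=> a0 ua; rewrite [leLHS]mx_normrE; apply/bigmax_leP; split=> // -[i j] _ /=.
by rewrite ord1.
Qed.

Lemma normr_dot_le (u v : 'rV[R]_n) : `|dot u v| <= n%:R * `|u| * `|v|.
Proof.
rewrite -mulrA; apply: le_trans (ler_norm_sum _ _ _) _.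
apply: le_trans (_ : \sum_(i < n) `|u| * `|v| <= _).
  by apply: ler_sum => i _; rewrite normrM ler_pM ?normr_coord.
by rewrite sumr_const card_ord mulr_natl.
Qed.

Lemma cvg_dot {T : Type} {F : set_system T} {FF : Filter F}
    (f g : T -> 'rV[R]_n) u v :
  f x @[x --> F] --> u -> g x @[x --> F] --> v ->
  dot (f x) (g x) @[x --> F] --> dot u v.
Proof.
move=> fu gv; apply: cvg_big => [|i _]; first exact: add_continuous.
by apply: cvgM; [exact: (cvg_comp _ _ fu (@coord_continuous R 1 n ord0 i u))|
                exact: (cvg_comp _ _ gv (@coord_continuous R 1 n ord0 i v))].
Qed.

Lemma cvg_enorm {T : Type} {F : set_system T} {FF : Filter F}
    (f : T -> 'rV[R]_n) u :
  f x @[x --> F] --> u -> enorm (f x) @[x --> F] --> enorm u.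
Proof.
move=> fu; rewrite /enorm; exact: (cvg_comp _ _ (cvg_dot fu fu) (@sqrt_continuous R (dot u u))).
Qed.

End euclidean.

(** * Convexity with real weights and real upper bounds *)

Section convexity.
Context {R : realType}.

Lemma convex_setP n (A : set 'rV[R]_n) :
  @convex_set R 'rV[R]_n A <->
  forall u v (t : R), 0 <= t -> t <= 1 -> A u -> A v ->
    A (t *: u + (1 - t) *: v).
Proof.
split=> [cA u v t t0 t1 Au Av|cA u v t]; last first.
  by rewrite !inE => Au Av; apply: cA.
have t01 : Itv.spec (@Itv.num_sem R) (Itv.Real `[0%Z, 1%Z]) t.
  by apply/and3P; split; rewrite /= ?num_real //= ?bnd_simp ?t0 ?t1.
by have := cA u v (Itv.mk t01); rewrite !inE; apply.
Qed.

(** Real bounds [a] and [b] replace the values of [h], so infinite values never enter the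
    arithmetic. *)
Lemma efun_convexP n (h : 'rV[R]_n -> \bar R) :
  efun_convex h <->
  forall u v (t a b : R), 0 <= t -> t <= 1 -> (h u <= a%:E)%E -> (h v <= b%:E)%E ->
    (h (t *: u + (1 - t) *: v)%R <= (t * a + (1 - t) * b)%:E)%E.
Proof.
have avgE u v (t a b : R) :
    t *: row_mx u a%:M + (1 - t) *: row_mx v b%:M =
    row_mx (t *: u + (1 - t) *: v) (t * a + (1 - t) * b)%:M :> 'rV[R]_(n + 1).
  by rewrite !scale_row_mx add_row_mx !scale_scalar_mx -raddfD.
split=> [ch u v t a b t0 t1 hu hv|ch].
  apply/epiE; rewrite -avgE.
  have := (convex_setP (epi h)).1 ch (row_mx u a%:M) (row_mx v b%:M) t t0 t1.
  by apply; apply/epiE.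
apply: (convex_setP _).2 => _ _ t t0 t1 [[u a] /= hu <-] [[v b] /= hv <-].
by rewrite avgE; apply/epiE; exact: ch.
Qed.

End convexity.

(** * Caratheodory's theorem and separation *)

Section caratheodory.
Context {R : realType} {n : nat}.
Implicit Types (A B K : set 'rV[R]_n) (x : 'rV[R]_n) (N : nat).

(** Zero weights and repeated points are allowed, so this set is the image of the standard simplex
    times the [N]-th power of [A]. *)
Definition combos N A : set 'rV[R]_n :=
  [set p | exists (c : 'I_N -> R) (a : 'I_N -> 'rV[R]_n),
    [/\ forall i, 0 <= c i, \sum_i c i = 1, forall i, A (a i) &
        p = \sum_i c i *: a i]].

(** Induction on [N]: the first point is split off and the others are rescaled by their total weight
    [s]. *)
Lemma combos_sub_convex N A B :
  @convex_set R 'rV[R]_n B -> A `<=` B -> combos N A `<=` B.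
Proof.
move=> /convex_setP cB AB; elim: N => [|N IHN] _ [c [a [c0 c1 Aa ->]]].
  by move: c1; rewrite big_ord0 => /eqP; rewrite eq_sym oner_eq0.
rewrite big_ord_recl; move: c1; rewrite big_ord_recl => c1.
set s := \sum_(i < N) _ in c1.
have s0 : 0 <= s by exact: sumr_ge0.
have sE : s = 1 - c ord0 by rewrite -c1 addrC addKr.
have [s_eq0|s_neq0] := eqVneq s 0.
  rewrite big1 => [|i _].
    have -> : c ord0 = 1 by lra.
    by rewrite addr0 scale1r; exact: AB.
  by rewrite (psumr_eq0P _ s_eq0) ?scale0r.
rewrite (_ : \sum_(i < N) _ = s *: \sum_(i < N) (c (lift ord0 i) / s) *: a (lift ord0 i)).
  rewrite {1}sE; apply: cB => //; [by lra|exact: AB|].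
  apply: IHN; exists (fun i => c (lift ord0 i) / s), (fun i => a (lift ord0 i)).
  split=> [i||i|] //; first exact: divr_ge0.
  by rewrite -mulr_suml divff.
rewrite scaler_sumr; apply: eq_bigr => i _.
by rewrite scalerA mulrCA divff ?mulr1.
Qed.

(** With a column of ones appended, the points are the rows of a matrix with more rows than columns,
    so its left kernel is nonzero. The column of ones makes the coefficients sum to 0, hence one of
    them is positive. *)
Lemma affine_dependence N (a : 'I_N.+1 -> 'rV[R]_n) : (n < N)%N ->
  exists v : 'I_N.+1 -> R,
    [/\ \sum_i v i = 0, \sum_i v i *: a i = 0 & exists i, 0 < v i].
Proof.
move=> nN; pose M := row_mx (\matrix_i a i) (const_mx 1 : 'cV[R]_N.+1).
have : kermx M != 0.
  by rewrite -mxrank_eq0 mxrank_ker -lt0n subn_gt0 (leq_ltn_trans (rank_leq_col _)) // addn1.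
case/rowV0Pn => v /sub_kermxP; rewrite mul_mx_row => vM v0.
have /eq_row_mx[va v1] : row_mx (v *m \matrix_i a i) (v *m (const_mx 1 : 'cV[R]_N.+1)) =
    row_mx 0 0 by rewrite vM row_mx0.
have sum_v : \sum_i v ord0 i = 0.
  move/matrixP/(_ ord0 ord0): v1; rewrite [in X in _ = X]mxE => v1.
  by rewrite -[RHS]v1 mxE; apply: eq_bigr => i _; rewrite mxE mulr1.
exists (v ord0); split=> //.
  by rewrite -[RHS]va mulmx_sum_row; apply: eq_bigr => i _; rewrite rowK.
apply/existsP; apply: contraNT v0; rewrite negb_exists => /forallP v_le0.
apply/eqP/rowP => i; rewrite mxE; apply: oppr_inj; rewrite oppr0.
apply: (psumr_eq0P (P := xpredT) (F := fun i => - v ord0 i)) => // [j _|].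
  by rewrite oppr_ge0 leNgt.
by rewrite sumrN sum_v oppr0.
Qed.

(** Caratheodory's reduction: subtracting a multiple of an affine dependence changes neither the
    point nor the total weight. *)
Lemma combos_drop N A : (n < N)%N -> combos N.+1 A `<=` combos N A.
Proof.
move=> nN _ [c [a [c0 c1 Aa ->]]].
have [v [v_sum va [i1 vi1]]] := affine_dependence a nN.
(* The minimal ratio is the largest multiple of [v] that keeps all weights nonnegative, and it
   cancels the weight at [i0]. *)
pose i0 := [arg min_(i < i1 | 0 < v i) (c i / v i)]%O.
have [vi0 i0_min] : 0 < v i0 /\ forall j, 0 < v j -> c i0 / v i0 <= c j / v j.
  by rewrite /i0; case: arg_minP.
pose r := c i0 / v i0; pose c' i := c i - r * v i.
have r0 : 0 <= r by rewrite divr_ge0 // ltW.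
have c'0 i : 0 <= c' i.
  rewrite subr_ge0; have [vi|vi] := ltP 0 (v i).
    by rewrite -ler_pdivlMr // i0_min.
  exact: le_trans (mulr_ge0_le0 r0 vi) (c0 i).
have c'i0 : c' i0 = 0 by rewrite /c' /r divfK ?subrr // gt_eqF.
have bigi0 (V : zmodType) (F : 'I_N.+1 -> V) : F i0 = 0 ->
    \sum_i F i = \sum_(i < N) F (lift i0 i).
  by move=> Fi0; rewrite (bigD1_ord i0) //= Fi0 add0r.
exists (fun i => c' (lift i0 i)), (fun i => a (lift i0 i)); split=> //.
  by rewrite -bigi0 // sumrB -mulr_sumr v_sum mulr0 subr0.
rewrite -(bigi0 _ (fun i => c' i *: a i)) ?c'i0 ?scale0r //.
rewrite [RHS](eq_bigr (fun i => c i *: a i - r *: (v i *: a i))) => [|i _].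
  by rewrite sumrB -scaler_sumr va scaler0 subr0.
by rewrite scalerBl scalerA.
Qed.

(** Two combinations are concatenated into one of twice the length, and Caratheodory's reduction
    brings it back to [n.+1] terms. *)
Lemma combos_convex A : @convex_set R 'rV[R]_n (combos n.+1 A).
Proof.
have reduce k : combos (k + n.+1) A `<=` combos n.+1 A.
  elim: k => [//|k IHk] p pk; apply: IHk; apply: combos_drop pk.
  exact: leq_addl.
apply/convex_setP => _ _ t t0 t1 [c [a [c0 c1 Aa ->]]] [d [b [d0 d1 Ab ->]]].
apply: (reduce n.+1).
exists (fun i => match fintype.split i with inl j => t * c j | inr j => (1 - t) * d j end),
  (fun i => match fintype.split i with inl j => a j | inr j => b j end).
have splitl j : fintype.split (lshift n.+1 j) = inl j :> 'I_n.+1 + 'I_n.+1 by exact: (unsplitK (inl j)).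
have splitr j : fintype.split (rshift n.+1 j) = inr j :> 'I_n.+1 + 'I_n.+1 by exact: (unsplitK (inr j)).
split=> [i|||].
- by case: fintype.split => j; rewrite mulr_ge0 // subr_ge0.
- rewrite big_split_ord /=; under eq_bigr do rewrite splitl.
  under [X in _ + X]eq_bigr do rewrite splitr.
  by rewrite -!mulr_sumr c1 d1; lra.
- by move=> i; case: fintype.split.
- rewrite big_split_ord /= !scaler_sumr; congr (_ + _); apply: eq_bigr => i _.
    by rewrite splitl scalerA.
  by rewrite splitr scalerA.
Qed.

Lemma sub_combos N A : A `<=` combos N.+1 A.
Proof.
move=> p Ap; exists (fun i => (i == ord0)%:R), (fun=> p); split=> //.
- by rewrite (bigD1 ord0) //= big1 ?addr0 // => i /negPf ->.
- by rewrite -scaler_suml (bigD1 ord0) //= big1 ?addr0 ?scale1r // => i /negPf ->.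
Qed.

(** Continuous image of the compact simplex times a power of [A], compact by Tychonoff. *)
Lemma combos_compact N A : compact A -> compact (combos N A).
Proof.
move=> cA.
pose simplex := [set c : 'rV[R]_N | (forall i, 0 <= c ord0 i) /\ \sum_i c ord0 i = 1].
have simplex_compact : compact simplex.
  apply: bounded_closed_compact.
    exists 1; split=> // r r1 c [c0 c1].
    apply: ler_mx_norm_coord => [|i]; first lra.
    rewrite ger0_norm //; apply: le_trans (ltW r1); rewrite -c1 (bigD1 i) //=.
    by rewrite lerDl sumr_ge0.
  have -> : simplex = \bigcap_i [set c : 'rV[R]_N | 0 <= c ord0 i] `&`
      [set c : 'rV[R]_N | \sum_i c ord0 i = 1].
    apply/seteqP; split=> [c [c0 c1]|c [c0 c1]]; first by split=> // i _; exact: c0.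
    by split=> // i; exact: c0.
  apply: closedI.
    apply: closed_bigI => i _.
    apply: (@preimage_closed _ _ (fun c : 'rV[R]_N => c ord0 i) [set r | 0 <= r]) => [c _|].
      exact: coord_continuous.
    exact: closed_ge.
  apply: (@preimage_closed _ _ (fun c : 'rV[R]_N => \sum_i c ord0 i) [set 1]) => [c _|].
    move: c; apply: continuous_big => [|i _]; first exact: add_continuous.
    exact: coord_continuous.
  exact: closed_eq.
have := @tychonoff 'I_N (fun=> 'rV[R]_n) (fun=> A) (fun=> cA).
move=> /(compact_setX simplex_compact) /continuous_compact.
move=> /(_ _ (fun q => \sum_i q.1 ord0 i *: q.2 i)).
rewrite (_ : [set _ | _ in _] = combos N A).
  apply; apply: continuous_subspaceT.
  apply: continuous_big => [|i _ q]; first exact: add_continuous.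
  apply: cvgZ.
    apply: (@continuous_comp _ _ _ fst (fun c : 'rV[R]_N => c ord0 i) q); first exact: cvg_fst.
    exact: coord_continuous.
  have proj_i := @proj_continuous 'I_N (fun=> 'rV[R]_n) i q.2.
  have cvg_q2 := @cvg_snd _ _ (nbhs q.1) (nbhs q.2) _ _.
  exact: (cvg_comp _ (proj i) (cvg_q2 _) proj_i).
apply/seteqP; split=> [_ [[c a] [[/= c0 c1] Aa] <-]|_ [c [a [c0 c1 Aa ->]]]].
  by exists (c ord0), a.
exists (\row_i c i, a) => /=; first by split=> //; split=> [i|]; [rewrite mxE|under eq_bigr do rewrite mxE].
by apply: eq_bigr => i _; rewrite mxE.
Qed.

(** The separating direction is [x - p], with [p] a point of [K] nearest to [x], and the margin is
    the squared distance. *)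
Lemma convex_compact_separation K x :
  @convex_set R 'rV[R]_n K -> compact K -> ~ K x ->
  exists (d : 'rV[R]_n) (e : R), 0 < e /\ forall k, K k -> dot d k <= dot d x - e.
Proof.
move=> /convex_setP cvxK cK Kx.
have [->|/set0P K0] := eqVneq K set0; first by exists 0, 1.
have [] := @EVT_min_rV R n (fun k => dot (x - k) (x - k)) K K0 cK.
  apply: continuous_subspaceT => k.
  have xk : x - j @[j --> k] --> x - k by apply: cvgB; [exact: nbhs_filter|apply: cvg_cst; exact: nbhs_filter|].
  exact: (cvg_dot xk xk).
move=> p; rewrite inE => Kp p_min; exists (x - p), (dot (x - p) (x - p)); split.
  by apply: dot_gt0; rewrite subr_eq0; apply: contra_notN Kx => /eqP ->.
move=> k Kk; set d := x - p.
have -> : dot d x - dot d d = dot d p by rewrite -dotNr -dotDr opprB addrC subrK.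
rewrite -subr_le0 -dotNr -dotDr; set h := k - p.
rewrite leNgt; apply/negP => dh.
(* If [dot d h] were positive, a step [t] from [p] towards [k] would change the squared distance by
   [- 2 * t * dot d h + t ^+ 2 * dot h h], which is negative for this [t]. *)
pose t := Num.min 1 (dot d h / (1 + dot h h)).
have hh := dot_ge0 h.
have t0 : 0 < t by rewrite lt_min ltr01 divr_gt0 //; lra.
have t1 : t <= 1 by rewrite ge_min lexx.
have thh : t * (1 + dot h h) <= dot d h.
  by rewrite -ler_pdivlMr ?ge_min ?lexx ?orbT //; lra.
have /p_min : t *: k + (1 - t) *: p \in K by rewrite inE; apply: cvxK => //; exact: ltW.
have -> : x - (t *: k + (1 - t) *: p) = d + (- t) *: h.
  by apply/rowP => i; rewrite !mxE; ring.
rewrite dot_sqrDZ; nra.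
Qed.

(** [B] is only known to be convex, so [x] is separated from the convex combinations of [A], which
    form a compact convex set inside [B]. *)
Lemma compact_hull_separation A B x :
  compact A -> @convex_set R 'rV[R]_n B -> A `<=` B -> ~ B x ->
  exists (d : 'rV[R]_n) (e : R), 0 < e /\ forall a, A a -> dot d a <= dot d x - e.
Proof.
move=> cA cB AB Bx.
have [|d [e [e0 de]]] := convex_compact_separation
    (@combos_convex A) (combos_compact (N := n.+1) cA) (x := x).
  by move=> /(combos_sub_convex cB AB).
by exists d, e; split=> // a /(@sub_combos n) /de.
Qed.

End caratheodory.

(** * Subdifferentials of a convex function minus a quadratic *)

Section limits.
Context {R : realType}.

Lemma cvg_rV n {T : Type} {F : set_system T} {FF : Filter F}
    (f : T -> 'rV[R]_n) (u : 'rV[R]_n) :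
  (forall i, f x ord0 i @[x --> F] --> u ord0 i) -> f x @[x --> F] --> u.
Proof.
move=> fu S [P nP PS]; have : F [set x | forall i, P ord0 i (f x ord0 i)].
  by apply: filter_forall => i; exact: fu (nP ord0 i).
by move=> /filterS; apply => x Px; apply: PS => i j; rewrite ord1.
Qed.

Lemma near_enorm n (x : 'rV[R]_n) (c e : R) : 0 < e ->
  \forall y \near x, c * enorm (y - x) <= e.
Proof.
move=> e0; have : c * enorm (y - x) @[y --> x] --> (c * enorm (x - x) : R).
  have FF : Filter (nbhs x) by exact: nbhs_filter.
  apply: (cvgM (cvg_cst c)); apply: cvg_enorm.
  by apply: cvgB => //; exact: cvg_cst.
by move=> /cvgr_le; apply; rewrite subrr /enorm dot0l sqrtr0 mulr0.
Qed.

(** A single small [t] suffices in the uses below: convexity compares the value there with the value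
    at the far end of the segment. *)
Lemma near_segment n (x h : 'rV[R]_n) (P : set 'rV[R]_n) :
  (\forall y \near x, P y) -> exists t : R, [/\ 0 < t, t <= 1 & P (x + t *: h)].
Proof.
move=> Px; have : x + t *: h @[t --> 0^'+] --> x.
  rewrite -[X in _ --> X]addr0 -(scale0r h); apply: cvgD; first exact: cvg_cst.
  apply: cvgZ; last exact: cvg_cst.
  by apply: cvg_at_right_filter.
move=> /(_ _ Px) /= Pt.
have /filter_ex[t [[t0 t1] Pxt]] :
    \forall t \near 0^'+, (0 < t /\ t <= 1) /\ P (x + t *: h).
  near=> t; split; first split.
  - by near: t; exact: nbhs_right_gt.
  - by near: t; apply: nbhs_right_le.
  - by near: t.
by exists t.
Unshelve. all: by end_near. Qed.

Lemma row_mx_scalarE n (u : 'rV[R]_n) (a : R) j :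
  (row_mx u a%:M : 'rV[R]_(n + 1)) ord0 (rshift n j) = a.
Proof. by rewrite (ord1 j) row_mxEr !mxE mulr1n. Qed.

Lemma dot_row_mx n (u v : 'rV[R]_n) (a b : R) :
  dot (row_mx u a%:M : 'rV[R]_(n + 1)) (row_mx v b%:M) = dot u v + a * b.
Proof.
rewrite /dot big_split_ord /= big_ord1 !row_mx_scalarE; congr (_ + _).
by apply: eq_bigr => i _; rewrite !row_mxEl.
Qed.

Lemma sub_row_mx n (u v : 'rV[R]_n) (a b : R) :
  row_mx u a%:M - row_mx v b%:M = row_mx (u - v) (a - b)%:M :> 'rV[R]_(n + 1).
Proof. by rewrite opp_row_mx add_row_mx raddfB. Qed.

Lemma ler_eps (a b k : R) : 0 <= k -> (forall e, 0 < e -> a <= b + e * k) -> a <= b.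
Proof.
move=> k0 ab; apply/ler_addgt0Pr => e e0.
apply: le_trans (ab (e / (1 + k)) _) _; first by rewrite divr_gt0 //; lra.
by rewrite lerD2l mulrAC ler_pdivrMr ?ler_pM2l; lra.
Qed.

End limits.

Section shifted_convex.
Context {R : realType} {n : nat} (Phi : 'rV[R]_n -> \bar R) (c : R).
Hypotheses (c_ge0 : 0 <= c) (Phi_gtNy : forall x, (-oo < Phi x)%E)
  (Phi_convex : efun_convex Phi).
Implicit Types (x y s v : 'rV[R]_n).

Let phi x := (Phi x - (c * dot x x)%:E)%E.

Let phi_le x (a : R) : (phi x <= a%:E)%E = (Phi x <= (a + c * dot x x)%:E)%E.
Proof. by rewrite /phi leeBlDr // EFinD. Qed.

Let dot_shift x y :
  dot y y = dot x x + 2 * dot x (y - x) + dot (y - x) (y - x).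
Proof.
have {1 2}-> : y = x + 1 *: (y - x) by rewrite scale1r addrC subrK.
by rewrite dot_sqrDZ expr1n mulr1 mul1r.
Qed.

Lemma domP x : efun_dom phi x <-> exists r, Phi x = r%:E.
Proof.
rewrite /efun_dom /phi /=; have := Phi_gtNy x.
case: (Phi x) => [r| |] // _; last by split=> [|[]].
by split=> _; [exists r|rewrite ltey].
Qed.

Lemma fenchel_PhiP x s r : Phi x = r%:E ->
  fenchel_subdiff Phi x s <->
  forall y b, Phi y = b%:E -> r + dot s (y - x) <= b.
Proof.
move=> Phix; split=> [[_ sP] y b Phiy|sP].
  by have := sP y; rewrite Phix Phiy -EFinD lee_fin.
split=> [|y]; first by rewrite /efun_dom /= Phix ltey.
rewrite Phix; have := Phi_gtNy y; case Phiy: (Phi y) => [b| |] // _.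
  by rewrite -EFinD lee_fin; exact: sP.
exact: leey.
Qed.

Lemma Phi_segment u y (t a b : R) : 0 <= t -> t <= 1 ->
  (Phi u <= a%:E)%E -> (Phi y <= b%:E)%E ->
  (Phi (u + t *: (y - u))%R <= (a + t * (b - a))%:E)%E.
Proof.
move=> t0 t1 ua yb; have := (efun_convexP _).1 Phi_convex y u t b a t0 t1 yb ua.
have -> : t *: y + (1 - t) *: u = u + t *: (y - u).
  by apply/rowP => i; rewrite !mxE; ring.
by have -> : t * b + (1 - t) * a = a + t * (b - a) by ring.
Qed.

(** The quadratic has gradient [(2 * c) *: x], and its second-order remainder is absorbed by the
    Frechet error term. Convexity of [Phi] along segments turns the local inequality into a global
    one. *)
Lemma frechet_shifted x s :
  frechet_subdiff phi x s <-> fenchel_subdiff Phi x (s + (2 * c) *: x).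
Proof.
split=> [[/domP[r Phix] sP]|sP].
  apply/(fenchel_PhiP _ Phix) => y b Phiy; set h := y - x.
  apply: (ler_eps (k := enorm h)); first exact: enorm_ge0.
  move=> e /sP /(near_segment h)[t [t0 t1]].
  have xr : (Phi x <= r%:E)%E by rewrite Phix.
  have yb : (Phi y <= b%:E)%E by rewrite Phiy.
  have := Phi_segment (ltW t0) t1 xr yb.
  have -> : x + t *: h - x = t *: h by rewrite addrC addKr.
  rewrite -/h enormZ ?(ltW t0) // dotZr {1}/phi Phix -!EFinD => Phit phit.
  have {phit} : ((r - c * dot x x + (t * dot s h - e * (t * enorm h)))%:E <=
      (r + t * (b - r) - c * dot (x + t *: h) (x + t *: h))%:E)%E.
    by apply: le_trans phit _; rewrite phi_le subrK.
  rewrite lee_fin dot_sqrDZ dotDl dotZl => ineq.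
  have hh := dot_ge0 h.
  have chh : 0 <= c * t ^+ 2 * dot h h by exact: mulr_ge0 (mulr_ge0 c_ge0 (sqr_ge0 t)) hh.
  rewrite -(ler_pM2l t0); nra.
have [/= + _] := sP; rewrite /efun_dom /= => domx.
have [r Phix] : exists r, Phi x = r%:E.
  by move: domx (Phi_gtNy x); case: (Phi x) => // r _ _; exists r.
split=> [|e e0]; first by apply/domP; exists r.
have := near_enorm x c e0; apply: filterS => y ye.
have := Phi_gtNy y; rewrite /phi Phix; case Phiy: (Phi y) => [b| |] // _.
  have := (fenchel_PhiP _ Phix).1 sP y b Phiy.
  rewrite -!EFinD lee_fin (dot_shift x y); set h := y - x.
  rewrite dotDl dotZl -(enormE h) => ineq.
  have := ler_wpM2r (enorm_ge0 h) ye; rewrite -/h; nra.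
by rewrite addye // leey.
Qed.


(** In the form of Fenchel inequalities for [Phi], the Frechet subgradients along a sequence pass to
    the limit, since the function values converge too. *)
Lemma limiting_shifted x : limiting_subdiff phi x = frechet_subdiff phi x.
Proof.
apply/seteqP; split=> [s [domx [xk [sk [cvg_x cvg_phi sP cvg_s]]]]|s sP]; last first.
  split; first by case: sP.
  by exists (fun=> x), (fun=> s); split=> //; exact: cvg_cst.
apply/frechet_shifted; have [r Phix] := (domP x).1 domx.
apply/(fenchel_PhiP _ Phix) => y b Phiy.
have phix : phi x = (r - c * dot x x)%:E by rewrite /phi Phix.
move: cvg_phi; rewrite phix => /fine_cvgP[_ cvg_phi].
have cvg_s' : sk k + (2 * c) *: xk k @[k --> \oo] --> s + (2 * c) *: x.
  by apply: cvgD => //; apply: cvgZ => //; exact: cvg_cst.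
have cvg_h : y - xk k @[k --> \oo] --> y - x by apply: cvgB => //; exact: cvg_cst.
have cvg_sq : c * dot (xk k) (xk k) @[k --> \oo] --> c * dot x x.
  by apply: cvgM; [exact: cvg_cst|exact: cvg_dot].
have := cvgD (cvgD cvg_phi cvg_sq) (cvg_dot cvg_s' cvg_h).
rewrite subrK => lim; apply: (cvgr_to_le (lim _ _ _)).
apply: nearW => k /=.
have [rk Phixk] := (domP (xk k)).1 (sP k).1.
have /frechet_shifted /(fenchel_PhiP _ Phixk) /(_ y b Phiy) := sP k.
by move=> le_b; apply: le_trans le_b; rewrite !fctE /= /phi Phixk /= subrK.
Qed.

(** The second vector points from [(u, a)] into the epigraph of [phi]: it is the direction to
    [(y, b)] in the epigraph of [Phi], corrected by the linear part of the quadratic. The segment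
    stays inside because the omitted quadratic remainder only lowers [phi]. *)
Lemma frechet_normal_shifted u (a : R) (w : 'rV[R]_(n + 1)) :
  frechet_normal (epi phi) (row_mx u a%:M) w ->
  forall y b, (Phi y <= b%:E)%E ->
  dot w (row_mx (y - u) (b - (a + c * dot u u) - 2 * c * dot u (y - u))%:M) <= 0.
Proof.
move=> [/epiE ua wP] y b yb; set h := y - u; set d := row_mx h _.
apply: (ler_eps (k := enorm d)); first exact: enorm_ge0.
move=> e /wP /(near_segment d)[t [t0 t1]].
have -> : row_mx u a%:M + t *: d - row_mx u a%:M = t *: d by rewrite addrC addKr.
rewrite enormZ ?(ltW t0) // dotZr => segP; rewrite add0r -(ler_pM2l t0).
suff /segP : epi phi (row_mx u a%:M + t *: d) by rewrite (mulrCA e).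
rewrite scale_row_mx add_row_mx scale_scalar_mx -[X in row_mx _ X]raddfD.
apply/epiE; rewrite phi_le.
rewrite phi_le in ua; have := Phi_segment (ltW t0) t1 ua yb.
rewrite -/h => /le_trans; apply; rewrite lee_fin dot_sqrDZ.
have := mulr_ge0 (mulr_ge0 c_ge0 (sqr_ge0 t)) (dot_ge0 h); nra.
Qed.

(* The graph of the convex normal cone is closed and its fibres are closed and
   convex, so the limits, the convex hull and the closure in the definition of
   the Clarke normal cone add nothing. *)
Lemma clarke_normal_shifted x (r : R) (w : 'rV[R]_(n + 1)) :
  clarke_normal (epi phi) (row_mx x r%:M) w ->
  forall y b, (Phi y <= b%:E)%E ->
  dot w (row_mx (y - x) (b - (r + c * dot x x) - 2 * c * dot x (y - x))%:M) <= 0.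
Proof.
move=> wN y b yb; set d := row_mx _ _.
have [Ncvx Nclosed] : @convex_set R 'rV[R]_(n + 1) [set w | dot w d <= 0] /\
    closed [set w | dot w d <= 0].
  split.
    apply/convex_setP => v1 v2 t t0 t1 /= v1d v2d.
    by rewrite dotDl !dotZl; nra.
  apply: (@preimage_closed _ _ (fun v : 'rV[R]_(n + 1) => dot v d) [set p : R | p <= 0]) => [v _|]; last exact: closed_le.
  have FF : Filter (nbhs v) by exact: nbhs_filter.
  by apply: cvg_dot => //; exact: cvg_cst.
suff limN : limiting_normal (epi phi) (row_mx x r%:M) `<=` [set w | dot w d <= 0].
  move: wN; rewrite /clarke_normal => wN; rewrite -/([set w | dot w d <= 0] w).
  have /closure_id -> := Nclosed; apply: closure_subset wN.
  exact: smallest_sub.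
move=> {wN} {}w [_ [pk [wk [cvg_p wkN cvg_w]]]] /=.
(* Splitting the base points into position and height shows that the test directions [dk] at [pk]
   converge to [d]. *)
pose uk k : 'rV[R]_n := lsubmx (pk k); pose ak k : R := pk k ord0 (rshift n ord0).
have pkE k : pk k = row_mx (uk k) (ak k)%:M.
  rewrite -[LHS]hsubmxK; congr row_mx; apply/rowP => i.
  by rewrite !mxE ord1 eqxx mulr1n.
have cvg_coord i : pk k ord0 i @[k --> \oo] --> (row_mx x r%:M : 'rV[R]_(n + 1)) ord0 i.
  exact: (cvg_comp _ _ cvg_p (@coord_continuous R 1 (n + 1) ord0 i _)).
have cvg_u : uk k @[k --> \oo] --> x.
  apply: cvg_rV => i; have := cvg_coord (lshift 1 i); rewrite row_mxEl.
  by under eq_fun do rewrite pkE row_mxEl.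
have cvg_a : ak k @[k --> \oo] --> r.
  by have := cvg_coord (rshift n ord0); rewrite row_mx_scalarE.
have cvg_h : y - uk k @[k --> \oo] --> y - x by apply: cvgB => //; exact: cvg_cst.
pose dk k : 'rV[R]_(n + 1) := row_mx (y - uk k)
  (b - (ak k + c * dot (uk k) (uk k)) - 2 * c * dot (uk k) (y - uk k))%:M.
have cvg_d : dk k @[k --> \oo] --> d.
  apply: cvg_rV => i; rewrite /dk /d; case: (split_ordP i) => j ->.
    rewrite row_mxEl; under eq_fun do rewrite row_mxEl.
    exact: (cvg_comp _ _ cvg_h (@coord_continuous R 1 n ord0 j _)).
  rewrite row_mx_scalarE; under eq_fun do rewrite row_mx_scalarE.
  apply: cvgB.
    apply: cvgB; first exact: cvg_cst.
    by apply: cvgD => //; apply: cvgM; [exact: cvg_cst|exact: cvg_dot].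
  by apply: cvgM; [exact: cvg_cst|exact: cvg_dot].
apply: (cvgr_to_le (cvg_dot cvg_w cvg_d)); apply: nearW => k.
by apply: frechet_normal_shifted => //; rewrite -pkE.
Qed.

(** Testing a Clarke normal [(v, -1)] on the directions above gives the Fenchel inequality for
    [Phi]. Conversely a Frechet subgradient already gives a Frechet normal, reached by constant
    sequences. *)
Lemma clarke_shifted x : clarke_subdiff phi x = frechet_subdiff phi x.
Proof.
apply/seteqP; split=> [v [domx vN]|v vP].
  have [r Phix] := (domP x).1 domx.
  apply/frechet_shifted/(fenchel_PhiP _ Phix) => y b Phiy.
  have yb : (Phi y <= b%:E)%E by rewrite Phiy.
  have := clarke_normal_shifted vN yb.
  rewrite dot_row_mx /phi Phix /= subrK dotDl dotZl; lra.
have domx := vP.1; split=> //.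
have [r Phix] := (domP x).1 domx.
move/frechet_shifted/(fenchel_PhiP _ Phix) in vP.
have phix : phi x = (r - c * dot x x)%:E by rewrite /phi Phix.
rewrite phix /=; set p := row_mx _ _.
apply: subset_closure; apply: sub_gen_smallest.
have p_epi : epi phi p by apply/epiE; rewrite phix.
suff vN : frechet_normal (epi phi) p (row_mx v (-1)%:M).
  by split=> //; exists (fun=> p), (fun=> row_mx v (-1)%:M); split=> //; exact: cvg_cst.
split=> // e e0.
have := near_enorm p c e0; apply: filterS => p' + [[y b] /= yb p'E].
rewrite -{}p'E sub_row_mx dot_row_mx; set h := y - x; set q := row_mx _ _ => qe.
(* The error [c * dot h h] of the quadratic is thus at most [c * enorm q ^+ 2], which is at most
   [e * enorm q] near [p]. *)
have hq : dot h h <= enorm q ^+ 2 by rewrite enormE dot_row_mx lerDl -expr2 sqr_ge0.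
apply: le_trans (ler_wpM2r (enorm_ge0 q) qe); rewrite -mulrA -expr2.
apply: le_trans (ler_wpM2l c_ge0 hq).
move: yb; rewrite phi_le (dot_shift x y) -/h; have := Phi_gtNy y.
case Phiy: (Phi y) => [b'| |] // _; rewrite lee_fin => yb.
have := vP y b' Phiy; rewrite dotDl dotZl -/h; lra.
Qed.

End shifted_convex.

(** * Conjugates *)

Section conjugate.
Context {R : realType} {n : nat}.
Implicit Types (F : 'rV[R]_n -> \bar R) (Fc : 'rV[R]_n -> R) (s d w : 'rV[R]_n).

(* For finite-valued [Fc] this says [Fc s = sup_w (<s, w> - F w)]. *)
Definition is_conjugate F Fc :=
  (forall s w, ((dot s w - Fc s)%:E <= F w)%E) /\
  forall s (e : R), 0 < e ->
    exists w r, F w = r%:E /\ r < dot s w - Fc s + e.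

(** Since a conjugate gives the reverse inequality, these are the points of equality in
    Fenchel-Young. *)
Definition conj_argmax F Fc s := [set w | (F w <= (dot s w - Fc s)%:E)%E].

Lemma is_conjugate_le F Fc s w r : is_conjugate F Fc -> F w = r%:E ->
  dot s w - Fc s <= r.
Proof. by move=> [FFc _] Fw; have := FFc s w; rewrite Fw lee_fin. Qed.

Lemma dot_delta (i : 'I_n) w : dot (delta_mx ord0 i) w = w ord0 i.
Proof.
rewrite /dot (bigD1 i) //= mxE !eqxx mul1r big1 ?addr0 // => j /negPf ji.
by rewrite mxE ji andbF mul0r.
Qed.

(* A finite conjugate near [s] forces superlinear growth, so near-maximizers
   stay bounded when the slope moves a little. *)
Lemma near_argmax_bounded F Fc s d : is_conjugate F Fc ->
  exists t0 rho : R, 0 < t0 /\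
    forall t w r, 0 <= t -> t <= t0 -> F w = r%:E ->
      r < dot (s + t *: d) w - Fc (s + t *: d) + 1 -> `|w| <= rho.
Proof.
move=> FFc; have [w0 [r0 [Fw0 _]]] := FFc.2 s 1 ltr01.
(* Testing [F w] with the slopes [s] plus or minus a unit vector bounds the coordinate [i] of [w] by
   [C i + L + t * dot d w]. The choice of [t0] makes the last term at most half the norm of [w],
   which is then absorbed. *)
pose L := `|r0 - dot s w0| + `|dot d w0| + 1.
pose C i := `|Fc (s + delta_mx ord0 i)| + `|Fc (s - delta_mx ord0 i)|.
pose M := L + \sum_i C i.
have D0 : 0 <= n%:R * `|d| by rewrite mulr_ge0.
exists (Num.min 1 (2 * (n%:R * `|d| + 1))^-1), (2 * M); split.
  by rewrite lt_min ltr01 invr_gt0 mulr_gt0 // ltr_wpDl.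
move=> t w r t0; rewrite le_min => /andP[t1 td] Fw.
rewrite dotDl dotZl => rw.
have := is_conjugate_le (s + t *: d) FFc Fw0; rewrite dotDl dotZl => Fc_ge.
have tdw0 : t * - dot d w0 <= `|dot d w0|.
  apply: le_trans (_ : t * `|dot d w0| <= _); last by rewrite ler_piMl.
  by rewrite ler_wpM2l // lerNl -lerN2 opprK -normrN ler_norm.
have tdw : t * dot d w <= `|w| / 2.
  apply: le_trans (_ : t * (n%:R * `|d| * `|w|) <= _).
    by rewrite ler_wpM2l //; apply: le_trans (ler_norm _) (normr_dot_le _ _).
  rewrite mulrA mulrC ler_wpM2l //.
  apply: le_trans (ler_wpM2r D0 td) _.
  by rewrite invfM -mulrA ler_piMr // mulrC ler_pdivrMr; lra.
have := ler_norm (r0 - dot s w0) => Lr0.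
have C0 i : 0 <= C i by rewrite addr_ge0.
have coord i : `|w ord0 i| <= M + `|w| / 2.
  have CM : C i <= \sum_i C i by rewrite (bigD1 i) //= lerDl sumr_ge0.
  have := is_conjugate_le (s + delta_mx ord0 i) FFc Fw.
  have := is_conjugate_le (s - delta_mx ord0 i) FFc Fw.
  rewrite !dotDl dotNl dot_delta => lo hi.
  have := ler_norm (Fc (s + delta_mx ord0 i)).
  have := ler_norm (Fc (s - delta_mx ord0 i)).
  have := normr_ge0 (Fc (s + delta_mx ord0 i)).
  have := normr_ge0 (Fc (s - delta_mx ord0 i)).
  rewrite /M /L ler_norml; move: CM; rewrite /C => CM *; apply/andP; split; lra.
suff : `|w| <= M + `|w| / 2 by lra.
apply: ler_mx_norm_coord coord; rewrite addr_ge0 ?divr_ge0 //.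
by rewrite /M /L !addr_ge0 // sumr_ge0.
Qed.

(** For a level [a] strictly between [k w] and [F w], near [w] the function [F] stays above [a]
    while [k] stays below the midpoint of [k w] and [a]. *)
Lemma lsc_near F (k : 'rV[R]_n -> R) w : lower_semicontinuous F -> continuous k ->
  ((k w)%:E < F w)%E ->
  exists b, 0 < b /\ \forall y \near w, ((k y + b)%:E < F y)%E.
Proof.
move=> lscF ck kF; have [a ka aF] : exists2 a, k w < a & (a%:E < F w)%E.
  case: (F w) kF => [r| |] // kF; last by exists (k w + 1); rewrite ?ltry // ltrDl.
  by exists ((k w + r) / 2); move: kF; rewrite ?lte_fin => kF; lra.
exists ((a - k w) / 2); split; first lra.
have [V nV VF] := lscF _ _ aF.
have FF : Filter (nbhs w) by exact: nbhs_filter.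
have ky : \forall y \near w, k y < (a + k w) / 2.
  by have /cvgr_lt := ck w; apply; lra.
near=> y; have Vy : V y by near: y.
have ky' : k y < (a + k w) / 2 by near: y.
by apply: lt_trans (VF y Vy); rewrite lte_fin; lra.
Unshelve. all: by end_near. Qed.

Lemma continuous_slope Fc s : continuous (fun w => dot s w - Fc s).
Proof.
move=> w; have FF : Filter (nbhs w) by exact: nbhs_filter.
apply: cvgB; last exact: cvg_cst.
by apply: cvg_dot => //; exact: cvg_cst.
Qed.

(** Boundedness is the near-maximizer bound with no change of slope; the complement is open by lower
    semicontinuity. *)
Lemma conj_argmax_compact F Fc s : lower_semicontinuous F -> is_conjugate F Fc ->
  compact (conj_argmax F Fc s).
Proof.
move=> lscF FFc; apply: bounded_closed_compact.
  have [t0 [rho [t0_gt0 bnd]]] := near_argmax_bounded s 0 FFc.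
  exists rho; split; first exact: num_real.
  move=> M rhoM w; rewrite /conj_argmax /= => Fw; apply: le_trans (ltW rhoM).
  have := FFc.1 s w; case Fwr: (F w) Fw => [r| |] //; rewrite !lee_fin => Fw _.
  by apply: (bnd 0 w r) => //; rewrite ?ltW // scaler0 addr0; lra.
rewrite -[conj_argmax _ _ _]setCK; apply: open_closedC; rewrite openE => w.
rewrite /conj_argmax /= => /negP; rewrite -ltNge => /(lsc_near lscF (@continuous_slope Fc s)).
move=> [b [b0 nb]]; apply: filterS nb => y by_; apply/negP; rewrite -ltNge.
by apply: lt_trans by_; rewrite lte_fin ltrDl.
Qed.

Lemma compact_normr_le (rho : R) : compact [set w : 'rV[R]_n | `|w| <= rho].
Proof.
apply: bounded_closed_compact.
  by exists rho; split; [exact: num_real|move=> M rM w /= /le_trans; apply; exact: ltW].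
apply: (@preimage_closed _ _ (fun w : 'rV[R]_n => `|w|) [set r | r <= rho]) => [w _|].
  exact: norm_continuous.
exact: closed_le.
Qed.

End conjugate.

(** * Attainment in the dual problem *)

Section duality.
Context {R : realType} {n : nat} (F G : 'rV[R]_n -> \bar R).
Context (Fc Gc : 'rV[R]_n -> R) (alpha : R).
Hypotheses (alpha_gt0 : 0 < alpha) (alpha_lt1 : alpha < 1).
Hypotheses (F_conj : is_conjugate F Fc) (G_conj : is_conjugate G Gc).
Hypotheses (F_lsc : lower_semicontinuous F) (G_lsc : lower_semicontinuous G).
Implicit Types (x s d w v : 'rV[R]_n).

Let mix w v : 'rV[R]_n := alpha *: w + (1 - alpha) *: v.

Let dot_mix s w v : dot s (mix w v) = alpha * dot s w + (1 - alpha) * dot s v.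
Proof. by rewrite dotDr !dotZr. Qed.

Let mix_continuous : continuous (fun q : 'rV[R]_n * 'rV[R]_n => mix q.1 q.2).
Proof.
move=> q; apply: cvgD; apply: cvgZ; try exact: cvg_cst.
  exact: cvg_fst.
exact: cvg_snd.
Qed.

Let dot_mix_continuous d :
  continuous (fun q : 'rV[R]_n * 'rV[R]_n => dot d (mix q.1 q.2)).
Proof.
move=> q; apply: cvg_dot; first exact: cvg_cst.
exact: mix_continuous.
Qed.

Definition dual_minimizer x s := forall s',
  alpha * Fc s + (1 - alpha) * Gc s - dot s x <=
  alpha * Fc s' + (1 - alpha) * Gc s' - dot s' x.

(* Otherwise moving from [s] to [s + t *: d] decreases the dual objective to
   first order in [t], because near-maximizers at [s + t *: d] approach exact
   maximizers at [s]. *)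
Lemma dual_minimizer_direction x s d (e : R) : dual_minimizer x s -> 0 < e ->
  exists w v, [/\ conj_argmax F Fc s w, conj_argmax G Gc s v &
    dot d x - e < dot d (mix w v)].
Proof.
move=> s_min e0; apply: contrapT => noarg.
have {}noarg w v : conj_argmax F Fc s w -> conj_argmax G Gc s v ->
    dot d (mix w v) <= dot d x - e.
  by move=> ws vs; rewrite leNgt; apply/negP => dwv; apply: noarg; exists w, v.
have [t1 [rho1 [t1_gt0 bndF]]] := near_argmax_bounded s d F_conj.
have [t2 [rho2 [t2_gt0 bndG]]] := near_argmax_bounded s d G_conj.
(* Either a component misses being a maximizer by more than [b], or the mixture falls short in
   direction [d]. Each pair in the box has a neighbourhood where this holds for all small [b], so
   compactness yields one [b] for the whole box. *)
pose P (b : R) (q : 'rV[R]_n * 'rV[R]_n) :=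
  [\/ ((dot s q.1 - Fc s + b)%:E < F q.1)%E, ((dot s q.2 - Gc s + b)%:E < G q.2)%E |
      dot d (mix q.1 q.2) < dot d x - e / 2].
have [b [b_gt0 Pb]] : exists b, 0 < b /\
    forall w v, `|w| <= rho1 -> `|v| <= rho2 -> P b (w, v).
  have := compact_setX (@compact_normr_le R n rho1) (@compact_normr_le R n rho2).
  move=> /compact_near_coveringP /(_ R 0^'+ P _) box.
  have /filter_ex[b [b_gt0 boxb]] : \forall b \near 0^'+, 0 < b /\
      [set w : 'rV[R]_n | `|w| <= rho1] `*` [set v : 'rV[R]_n | `|v| <= rho2] `<=` P b.
    near=> b; split; first by near: b; exact: nbhs_right_gt.
    near: b; apply: box => -[w v] _.
    have [dwv|dwv] := ltP (dot d (mix w v)) (dot d x - e / 2).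
      have /cvgr_lt /(_ _ dwv) nq := @dot_mix_continuous d (w, v).
      by near=> q b; apply: Or33 => /=; near: q.
    have FFw : Filter (nbhs w) by exact: nbhs_filter.
    have FFv : Filter (nbhs v) by exact: nbhs_filter.
    have cvg_w := @cvg_fst _ _ (nbhs w) (nbhs v) _.
    have cvg_v := @cvg_snd _ _ (nbhs w) (nbhs v) _.
    have [Fw|Fw] := leP (F w) (dot s w - Fc s)%:E.
      have [Gv|Gv] := leP (G v) (dot s v - Gc s)%:E.
        by have := noarg _ _ Fw Gv; lra.
      have [b0 [b0_gt0 nv]] := lsc_near G_lsc (@continuous_slope _ _ Gc s) Gv.
      near=> q b; have bb0 : b <= b0 by near: b; exact: nbhs_right_le.
      apply: Or32.
      have qG : ((dot s q.2 - Gc s + b0)%:E < G q.2)%E.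
        by near: q; exact: cvg_v nv.
      by apply: le_lt_trans qG; rewrite lee_fin lerD2l.
    have [b0 [b0_gt0 nw]] := lsc_near F_lsc (@continuous_slope _ _ Fc s) Fw.
    near=> q b; have bb0 : b <= b0 by near: b; exact: nbhs_right_le.
    apply: Or31.
    have qF : ((dot s q.1 - Fc s + b0)%:E < F q.1)%E.
      by near: q; exact: cvg_w nw.
    by apply: le_lt_trans qF; rewrite lee_fin lerD2l.
  by exists b; split=> // w v wr vr; apply: boxb; split.
pose K := `|dot d x| + n%:R * `|d| * (rho1 + rho2).
pose beta := Num.min alpha (1 - alpha) * b.
have beta_gt0 : 0 < beta by rewrite mulr_gt0 // lt_min alpha_gt0 subr_gt0.
have betaF : beta <= alpha * b by rewrite ler_pM2r // ge_min lexx.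
have betaG : beta <= (1 - alpha) * b by rewrite ler_pM2r // ge_min lexx orbT.
have K0 : 0 <= `|K| + e by rewrite addr_ge0 // ltW.
(* The first two bounds keep near-maximizers in the box, the third makes the tolerance [t * e / 4]
   less than 1, and the last keeps the first-order terms below the weighted gap [beta]. *)
pose t := Num.min (Num.min t1 t2) (Num.min (e^-1) (beta / (1 + `|K| + e))).
have t_gt0 : 0 < t.
  by rewrite !lt_min t1_gt0 t2_gt0 invr_gt0 e0 divr_gt0 //; lra.
have [[tt1 tt2] [te tb]] :
    (t <= t1 /\ t <= t2) /\ (t * e <= 1 /\ t * (`|K| + e) < beta).
  have := lexx t; rewrite {2}/t !le_min => /andP[/andP[-> ->] /andP[te tb]].
  split=> //; split; first by rewrite -ler_pdivlMr ?div1r.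
  move: tb; rewrite ler_pdivlMr; last by lra.
  by apply: lt_le_trans; rewrite ltr_pM2l //; lra.
pose s' := s + t *: d.
have te0 : 0 < t * e / 4 by rewrite divr_gt0 // mulr_gt0.
have [w [r [Fw rw]]] := F_conj.2 s' _ te0.
have [v [r' [Gv rv]]] := G_conj.2 s' _ te0.
have w_bnd : `|w| <= rho1.
  by apply: (bndF t w r) => //; [exact: ltW|rewrite -/s'; lra].
have v_bnd : `|v| <= rho2.
  by apply: (bndG t v r') => //; [exact: ltW|rewrite -/s'; lra].
have rF := is_conjugate_le s F_conj Fw.
have rG := is_conjugate_le s G_conj Gv.
have := s_min s'; rewrite /s' dotDl dotZl -/s' => obj.
move: rw rv; rewrite {1 3}/s' !dotDl !dotZl => rw rv.
have alpha1_gt0 : 0 < 1 - alpha by rewrite subr_gt0.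
rewrite -(ltr_pM2l alpha_gt0) in rw; rewrite -(ltr_pM2l alpha1_gt0) in rv.
have gap : alpha * (r - (dot s w - Fc s)) + (1 - alpha) * (r' - (dot s v - Gc s)) <=
    t * (dot d (mix w v) - dot d x) + t * e / 4 by rewrite dot_mix; lra.
have gapF : 0 <= alpha * (r - (dot s w - Fc s)).
  by rewrite mulr_ge0 ?subr_ge0 // ltW.
have gapG : 0 <= (1 - alpha) * (r' - (dot s v - Gc s)).
  by rewrite mulr_ge0 ?subr_ge0 // ltW.
have gapK : t * (dot d (mix w v) - dot d x) + t * e / 4 <= t * (`|K| + e).
  have d0 : 0 <= n%:R * `|d| by rewrite mulr_ge0.
  have dx : - dot d x <= `|dot d x| by rewrite -normrN ler_norm.
  have dw := le_trans (ler_norm _) (le_trans (normr_dot_le d w) (ler_wpM2l d0 w_bnd)).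
  have dv := le_trans (ler_norm _) (le_trans (normr_dot_le d v) (ler_wpM2l d0 v_bnd)).
  have rho1_ge0 := le_trans (normr_ge0 w) w_bnd.
  have rho2_ge0 := le_trans (normr_ge0 v) v_bnd.
  have KK := ler_norm K.
  have dmix : dot d (mix w v) <= n%:R * `|d| * (rho1 + rho2).
    rewrite dot_mix mulrDr; apply: lerD.
      apply: le_trans (_ : alpha * (n%:R * `|d| * rho1) <= _); first by rewrite ler_pM2l.
      by rewrite ler_piMl ?mulr_ge0 // ltW.
    apply: le_trans (_ : (1 - alpha) * (n%:R * `|d| * rho2) <= _); first by rewrite ler_pM2l.
    by rewrite ler_piMl ?mulr_ge0 // gerDl oppr_le0 ltW.
  rewrite -mulrA -mulrDr ler_pM2l //; move: KK; rewrite {1}/K; lra.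
(* In the first two cases a gap of at least [beta] exceeds what [gapK] allows. In the third, the
   decrease [t * e / 2] outweighs the tolerance [t * e / 4], so the sum of two nonnegative gaps
   would be negative. *)
have [] := Pb w v w_bnd v_bnd; rewrite /= ?Fw ?Gv ?lte_fin => ineq.
- suff : alpha * b <= alpha * (r - (dot s w - Fc s)) by lra.
  by rewrite ler_pM2l //; lra.
- suff : (1 - alpha) * b <= (1 - alpha) * (r' - (dot s v - Gc s)) by lra.
  by rewrite ler_pM2l ?subr_gt0 //; lra.
- have : t * (dot d (mix w v) - dot d x) <= t * (- (e / 2)) by rewrite ler_pM2l //; lra.
  lra.
Unshelve. all: by end_near. Qed.

(** The admissible mixtures form a convex set [B] containing all mixtures of maximizers. If [x] were
    outside [B], a separating direction would contradict [dual_minimizer_direction]. *)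
Lemma dual_minimizer_decomposition x s : dual_minimizer x s ->
  exists u v, [/\ x = mix u v,
    (conv_fun F u <= (dot s u - Fc s)%:E)%E & (conv_fun G v <= (dot s v - Gc s)%:E)%E].
Proof.
move=> s_min.
pose B := [set p | exists u v, [/\ p = mix u v,
  (conv_fun F u <= (dot s u - Fc s)%:E)%E & (conv_fun G v <= (dot s v - Gc s)%:E)%E]].
apply: (@contrapT (B x)) => Bx.
pose A := [set mix q.1 q.2 | q in conj_argmax F Fc s `*` conj_argmax G Gc s].
have A_compact : compact A.
  apply: continuous_compact; first exact: continuous_subspaceT mix_continuous.
  by apply: compact_setX; exact: conj_argmax_compact.
have B_convex : @convex_set R 'rV[R]_n B.
  apply/convex_setP => _ _ t t0 t1 [u1 [v1 [-> Fu1 Gv1]]] [u2 [v2 [-> Fu2 Gv2]]].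
  exists (t *: u1 + (1 - t) *: u2), (t *: v1 + (1 - t) *: v2); split.
  - by apply/rowP => i; rewrite !mxE; ring.
  - have := (efun_convexP _).1 (@conv_fun_convex _ _ F) _ _ _ _ _ t0 t1 Fu1 Fu2.
    by move=> le_t; apply: le_trans le_t _; rewrite lee_fin dotDr !dotZr; lra.
  - have := (efun_convexP _).1 (@conv_fun_convex _ _ G) _ _ _ _ _ t0 t1 Gv1 Gv2.
    by move=> le_t; apply: le_trans le_t _; rewrite lee_fin dotDr !dotZr; lra.
have AB : A `<=` B.
  move=> _ [[w v] [/= ws vs] <-]; exists w, v; split=> //.
    exact: le_trans (conv_fun_le _ _) ws.
  exact: le_trans (conv_fun_le _ _) vs.
have [d [e [e0 dA]]] := compact_hull_separation A_compact B_convex AB Bx.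
have [w [v [ws vs]]] := dual_minimizer_direction d s_min e0.
by rewrite ltNge dA //; exists (w, v).
Qed.

End duality.

(** * Subgradients of the averaged conjugate *)

Section averaged_conjugate.
Context {R : realType} {n : nat} (F G Phi : 'rV[R]_n -> \bar R).
Context (Fc Gc : 'rV[R]_n -> R) (alpha : R).
Hypotheses (alpha_gt0 : 0 < alpha) (alpha_lt1 : alpha < 1).
Hypotheses (F_conj : is_conjugate F Fc) (G_conj : is_conjugate G Gc).
(* [Phi] is the conjugate of [alpha Fc + (1 - alpha) Gc]. *)
Hypothesis Phi_leP : forall x (b : R), (Phi x <= b%:E)%E <->
  forall s, dot s x - alpha * Fc s - (1 - alpha) * Gc s <= b.
Implicit Types (x s w v : 'rV[R]_n).

Let alpha1_gt0 : 0 < 1 - alpha. Proof. by rewrite subr_gt0. Qed.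

Lemma averaged_conjugate_gtNy x : (-oo < Phi x)%E.
Proof.
rewrite ltNye; apply/negP => /eqP PhixNy.
pose a := dot 0 x - alpha * Fc 0 - (1 - alpha) * Gc 0.
have /Phi_leP /(_ 0) : (Phi x <= (a - 1)%:E)%E by rewrite PhixNy leNye.
by rewrite -/a; lra.
Qed.

Lemma averaged_conjugate_convex : efun_convex Phi.
Proof.
apply/efun_convexP => u v t a b t0 t1 /Phi_leP ua /Phi_leP vb.
apply/Phi_leP => s; rewrite dotDr !dotZr.
have t1' : 0 <= 1 - t by lra.
by have := ler_wpM2l t0 (ua s); have := ler_wpM2l t1' (vb s); lra.
Qed.

(** Biconjugation is avoided: the subgradient inequality is tested at a mixture of near-maximizers
    for [s], where Fenchel-Young bounds [Phi] from above. *)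
Lemma subgradient_dual_le x s (r : R) : Phi x = r%:E -> fenchel_subdiff Phi x s ->
  alpha * Fc s + (1 - alpha) * Gc s <= dot s x - r.
Proof.
move=> Phix [_ sP]; apply/ler_addgt0Pr => e e0.
have [w [a [Fw aw]]] := F_conj.2 s e e0.
have [v [b [Gv bv]]] := G_conj.2 s e e0.
have : (Phi (alpha *: w + (1 - alpha) *: v)%R <= (alpha * a + (1 - alpha) * b)%:E)%E.
  apply/Phi_leP => s'; rewrite dotDr !dotZr.
  have := ler_wpM2l (ltW alpha_gt0) (is_conjugate_le s' F_conj Fw).
  have := ler_wpM2l (ltW alpha1_gt0) (is_conjugate_le s' G_conj Gv).
  lra.
move=> /(le_trans (sP _)); rewrite Phix -EFinD lee_fin.
rewrite dotDr dotNr dotDr !dotZr.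
have := ler_wpM2l (ltW alpha_gt0) (ltW aw).
have := ler_wpM2l (ltW alpha1_gt0) (ltW bv).
lra.
Qed.

Lemma subgradient_dual_minimizer x s (r : R) :
  Phi x = r%:E -> fenchel_subdiff Phi x s -> dual_minimizer Fc Gc alpha x s.
Proof.
move=> Phix sP s'; have := subgradient_dual_le Phix sP.
have /Phi_leP /(_ s') : (Phi x <= r%:E)%E by rewrite Phix.
lra.
Qed.

End averaged_conjugate.

(** * Points called in a convex hull and equality in Fenchel-Young *)

Section called.
Context {R : realType} {n : nat} (F : 'rV[R]_n -> \bar R) (Fc : 'rV[R]_n -> R).
Hypothesis F_conj : is_conjugate F Fc.
Implicit Types (p s w : 'rV[R]_n).

Lemma fenchel_argmaxP w s (r : R) : F w = r%:E ->
  fenchel_subdiff F w s <-> r <= dot s w - Fc s.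
Proof.
move=> Fw; split=> [[_ sP]|rs].
  apply/ler_addgt0Pr => e e0.
  have [v [b [Fv bv]]] := F_conj.2 s e e0.
  by have := sP v; rewrite Fw Fv -EFinD lee_fin dotDr dotNr; lra.
split=> [|v]; first by rewrite /efun_dom /= Fw ltry.
by rewrite Fw -EFinD; apply: le_trans (F_conj.1 s v); rewrite lee_fin dotDr dotNr; lra.
Qed.

(** The Fenchel-Young gap at [p], with [Y] as value, is a combination with positive weights of the
    nonnegative gaps at the points [xs i]; it vanishes exactly when all of them do. *)
Lemma called_byP p m (xs : 'I_m -> 'rV[R]_n) : called_by F p xs ->
  exists Y : R, [/\ conv_fun F p = Y%:E,
    forall s, dot s p - Fc s <= Y &
    forall s, Y <= dot s p - Fc s <-> forall i, fenchel_subdiff F (xs i) s].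
Proof.
move=> [_ xs_dom [a [a_gt0 a_sum -> ->]]].
have /choice[r Fxs] i : exists r, F (xs i) = r%:E.
  have := F_conj.1 0 (xs i); have := xs_dom i; rewrite /efun_dom /=.
  by case: (F (xs i)) => // r _ _; exists r.
have gapE s : \sum_i a i * r i - (dot s (\sum_i a i *: xs i) - Fc s) =
    \sum_i a i * (r i - (dot s (xs i) - Fc s)).
  rewrite dot_sumr -[X in _ - (_ - X)]mul1r -a_sum mulr_suml -!sumrB.
  by apply: eq_bigr => i _; rewrite dotZr; ring.
have gap0 s i : 0 <= a i * (r i - (dot s (xs i) - Fc s)).
  by apply: mulr_ge0; [exact: ltW|rewrite subr_ge0; exact: (is_conjugate_le s F_conj (Fxs i))].
exists (\sum_i a i * r i); split=> [|s|s].
- by rewrite -sumEFin; apply: eq_bigr => i _; rewrite Fxs EFinM.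
- by rewrite -subr_ge0 gapE sumr_ge0.
rewrite -subr_le0 gapE; split=> [gap_le0 i|sP]; last first.
  apply: sumr_le0 => i _; rewrite pmulr_rle0 // subr_le0.
  by apply/fenchel_argmaxP.
have gap_eq0 : \sum_i a i * (r i - (dot s (xs i) - Fc s)) = 0.
  by apply/eqP; rewrite eq_le gap_le0 sumr_ge0.
apply/(fenchel_argmaxP _ (Fxs i)); rewrite -subr_le0 -(pmulr_rle0 _ (a_gt0 i)).
by rewrite (psumr_eq0P _ gap_eq0).
Qed.

End called.

(** * Subgradients of the averaged conjugate at an exact decomposition *)

Section averaged_subdifferential.
Context {R : realType} {n : nat} (F G Phi : 'rV[R]_n -> \bar R).
Context (Fc Gc : 'rV[R]_n -> R) (alpha : R).
Hypotheses (alpha_gt0 : 0 < alpha) (alpha_lt1 : alpha < 1).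
Hypotheses (F_conj : is_conjugate F Fc) (G_conj : is_conjugate G Gc).
Hypotheses (F_lsc : lower_semicontinuous F) (G_lsc : lower_semicontinuous G).
Hypothesis Phi_leP : forall x (b : R), (Phi x <= b%:E)%E <->
  forall s, dot s x - alpha * Fc s - (1 - alpha) * Gc s <= b.

Lemma averaged_subdifferential (y z : 'rV[R]_n) (l m : nat)
    (ys : 'I_l -> 'rV[R]_n) (zs : 'I_m -> 'rV[R]_n) :
  inf_conv (epi_scale alpha (conv_fun F)) (epi_scale (1 - alpha) (conv_fun G)) (y + z)
    = (alpha%:E * conv_fun F (alpha^-1 *: y) +
       (1 - alpha)%:E * conv_fun G ((1 - alpha)^-1 *: z))%E ->
  called_by F (alpha^-1 *: y) ys -> called_by G ((1 - alpha)^-1 *: z) zs ->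
  fenchel_subdiff Phi (y + z) =
    (\bigcap_(i in [set: 'I_l]) fenchel_subdiff F (ys i)) `&`
    (\bigcap_(j in [set: 'I_m]) fenchel_subdiff G (zs j)).
Proof.
move=> exact_yz /(called_byP F_conj)[Y [convFY Y_ge YP]].
move=> /(called_byP G_conj)[Z [convGZ Z_ge ZP]].
have alpha1_gt0 : 0 < 1 - alpha by rewrite subr_gt0.
have dot_yz s : dot s (y + z) =
    alpha * dot s (alpha^-1 *: y) + (1 - alpha) * dot s ((1 - alpha)^-1 *: z).
  by rewrite dotDr !dotZr !mulrA !divff ?mul1r ?gt_eqF.
have Phi_gtNy := averaged_conjugate_gtNy Phi_leP.
have weak s : dot s (y + z) - alpha * Fc s - (1 - alpha) * Gc s <=
    alpha * Y + (1 - alpha) * Z.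
  rewrite dot_yz.
  have := ler_wpM2l (ltW alpha_gt0) (Y_ge s).
  have := ler_wpM2l (ltW alpha1_gt0) (Z_ge s).
  lra.
have [r Phir rV] : exists2 r, Phi (y + z) = r%:E & r <= alpha * Y + (1 - alpha) * Z.
  have := (Phi_leP _ _).2 weak; have := Phi_gtNy (y + z).
  by case: (Phi (y + z)) => [r| |] //; rewrite ?lee_fin => _ rV; exists r.
apply/seteqP; split=> [s sP|s [/= sF sG]]; last first.
  apply/(fenchel_PhiP Phi_gtNy _ Phir) => x b Phix.
  have /Phi_leP /(_ s) : (Phi x <= b%:E)%E by rewrite Phix.
  have := ler_wpM2l (ltW alpha_gt0) ((YP s).2 (fun i => sF i Logic.I)).
  have := ler_wpM2l (ltW alpha1_gt0) ((ZP s).2 (fun i => sG i Logic.I)).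
  by rewrite dotDr dotNr dot_yz; lra.
have s_min := subgradient_dual_minimizer alpha_gt0 alpha_lt1 F_conj G_conj Phi_leP Phir sP.
have [u [v [yz_uv Fu Gv]]] :=
  dual_minimizer_decomposition alpha_gt0 alpha_lt1 F_conj G_conj F_lsc G_lsc s_min.
have : ((alpha * Y + (1 - alpha) * Z)%:E <=
    (alpha * (dot s u - Fc s) + (1 - alpha) * (dot s v - Gc s))%:E)%E.
  have -> : (alpha * Y + (1 - alpha) * Z)%:E =
      inf_conv (epi_scale alpha (conv_fun F)) (epi_scale (1 - alpha) (conv_fun G)) (y + z).
    by rewrite exact_yz convFY convGZ EFinD !EFinM.
  (* This splitting of [y + z] makes the rescaled arguments exactly [u] and [v]. *)
  apply: ge_ereal_inf; exists (epi_scale alpha (conv_fun F) (y + z - (1 - alpha) *: v) +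
      epi_scale (1 - alpha) (conv_fun G) ((1 - alpha) *: v))%E.
    by exists ((1 - alpha) *: v).
  rewrite /epi_scale yz_uv addrK !scalerA !mulVf ?gt_eqF // !scale1r [leRHS]EFinD !EFinM.
  by apply: leeD; apply: lee_wpmul2l => //; rewrite lee_fin ltW.
rewrite lee_fin => V_le.
have dot_uv : dot s (y + z) = alpha * dot s u + (1 - alpha) * dot s v.
  by rewrite yz_uv dotDr !dotZr.
(* Both Fenchel-Young gaps are nonnegative and [V_le] makes their weighted sum nonpositive, so each
   is zero. *)
have hY := ler_wpM2l (ltW alpha_gt0) (Y_ge s).
have hZ := ler_wpM2l (ltW alpha1_gt0) (Z_ge s).
move: (dot_yz s); rewrite dot_uv => dotE.
split=> i _ /=.
  by apply: (YP s).1; rewrite -(ler_pM2l alpha_gt0); lra.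
by apply: (ZP s).1; rewrite -(ler_pM2l alpha1_gt0); lra.
Qed.

End averaged_subdifferential.

(** * The proximal average *)

Section moreau.
Context {R : realType} {n : nat} (f : 'rV[R]_n -> \bar R) (mu : R).
Hypotheses (f_proper : efun_proper f) (mu_gt0 : 0 < mu).
Hypothesis mu_lt : (mu%:E < prox_threshold f)%E.
Implicit Types (u w s : 'rV[R]_n).

Let c := (2 * mu)^-1.

(** A parameter [lam] larger than [mu] gives a quadratic minorant of [f] whose curvature is weaker
    than that of the envelope's penalty, so the sum is bounded below by completing the square. *)
Lemma moreau_env_fin_num u : moreau_env mu f u \is a fin_num.
Proof.
have [fNy [w0 fw0]] := f_proper.
rewrite fin_numE; apply/andP; split; last first.
  rewrite lt_eqF //; apply: le_lt_trans (ereal_inf_lbound _) _; first by exists w0.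
  by apply: lte_add_pinfty; [exact: fw0|exact: ltry].
have [_ [lam [lam_gt0 [x0 envx0]] <-] mu_lam] := ereal_sup_gt mu_lt.
rewrite lte_fin in mu_lam.
have [k kP] : exists k : R, forall w, (k%:E <= f w + ((2 * lam)^-1 * enorm (w - x0) ^+ 2)%:E)%E.
  have lb w : (moreau_env lam f x0 <= f w + ((2 * lam)^-1 * enorm (w - x0) ^+ 2)%:E)%E.
    by apply: ereal_inf_lbound; exists w.
  case: (moreau_env lam f x0) envx0 lb => [k| |] // _ lb; first by exists k.
  by exists 0 => w; apply: le_trans (lb w); rewrite leey.
pose b := (2 * lam)^-1.
have b_lt_c : b < c by rewrite ltf_pV2 ?posrE ?mulr_gt0 // ltr_pM2l.
have b_gt0 : 0 < b by rewrite invr_gt0 mulr_gt0.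
have cb_gt0 : 0 < c - b by rewrite subr_gt0.
pose h := u - x0.
rewrite gt_eqF //; apply: lt_le_trans (ltNyr (k - b * dot h h - b ^+ 2 / (c - b) * dot h h)) _.
apply: le_ereal_inf_tmp => _ [w _ <-]; have := kP w; have := fNy w.
case: (f w) => [r| |] // _; last by move=> _; rewrite addye // leey.
rewrite -!EFinD !lee_fin !enormE -/b -/c => kr.
set v := w - u; have wx0 : w - x0 = h + 1 *: v.
  by rewrite scale1r /h /v [RHS]addrC addrA subrK.
move: kr; rewrite wx0 dot_sqrDZ expr1n mulr1 mul1r => kr.
(* This square divided by [c - b] is the completed square. *)
have := dot_ge0 (b *: h + (- (c - b)) *: v); rewrite dot_sqrDZ !(dotZl, dotZr).
set hh := dot h h; set hv := dot h v; set vv := dot v v => sq_ge0.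
have : 0 <= (c - b) * vv - 2 * b * hv + b ^+ 2 / (c - b) * hh.
  rewrite -(pmulr_rge0 _ cb_gt0).
  rewrite [leRHS](_ : _ = b * (b * hh) + 2 * - (c - b) * (b * hv) + (- (c - b)) ^+ 2 * vv) //.
  by field; rewrite gt_eqF.
by rewrite -/hh -/hv -/vv in kr *; lra.
Qed.

(** The conjugate of [add_quad mu f]: expanding the square in the envelope at [mu *: s] turns the
    infimum into a supremum of [dot s w] minus that function. *)
Definition moreau_conj s : R := c * dot (mu *: s) (mu *: s) - fine (moreau_env mu f (mu *: s)).

Lemma moreau_envE u : moreau_env mu f u = (c * dot u u - moreau_conj (mu^-1 *: u))%:E.
Proof.
by rewrite /moreau_conj scalerA divff ?gt_eqF // scale1r subKr fineK //; exact: moreau_env_fin_num.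
Qed.

Let quadE u w : c * dot (w - u) (w - u) = c * dot w w - dot (mu^-1 *: u) w + c * dot u u.
Proof.
rewrite dotDl !dotDr !dotNl !dotNr dotZl (dotC w u) /c.
by field; rewrite gt_eqF.
Qed.

Lemma moreau_conjP : is_conjugate (add_quad mu f) moreau_conj.
Proof.
have [fNy _] := f_proper.
have scaleK s : mu^-1 *: (mu *: s) = s by rewrite scalerA mulVf ?gt_eqF // scale1r.
split=> [s w|s e e0].
  have : (moreau_env mu f (mu *: s) <= f w + (c * enorm (w - mu *: s) ^+ 2)%:E)%E.
    by apply: ereal_inf_lbound; exists w.
  rewrite moreau_envE scaleK /add_quad -/c !enormE quadE scaleK.
  have := fNy w; case: (f w) => [r| |] // _; last by move=> _; rewrite addye // leey.
  by rewrite -!EFinD !lee_fin; lra.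
have := lb_ereal_inf_adherent e0 (moreau_env_fin_num (mu *: s)).
case=> _ [w _ <-]; rewrite -/(moreau_env mu f (mu *: s)) moreau_envE scaleK -/c.
rewrite enormE quadE scaleK /add_quad; have := fNy w.
case fw: (f w) => [r| |] // _; rewrite -!EFinD lte_fin => lt_e.
by exists w, (r + c * dot w w); split; [rewrite fw enormE|lra].
Qed.

Lemma add_quad_lsc : lower_semicontinuous f -> lower_semicontinuous (add_quad mu f).
Proof.
move=> f_lsc x a; rewrite /add_quad -/c -lteBlDr // => afx.
have ck : continuous (fun w : 'rV[R]_n => a - c * enorm w ^+ 2).
  move=> w; have FF : Filter (nbhs w) by exact: nbhs_filter.
  apply: cvgB; first exact: cvg_cst.
  apply: cvgM; first exact: cvg_cst.
  by under eq_fun do rewrite enormE; rewrite enormE; exact: cvg_dot.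
have [b [b0 nb]] := lsc_near f_lsc ck afx.
exists [set y | ((a - c * enorm y ^+ 2 + b)%:E < f y)%E] => // y /= fy.
rewrite -/c -lteBlDr //; apply: lt_trans fy; rewrite lte_fin; lra.
Qed.

End moreau.

Section prox_average.
Context {R : realType} {n : nat} (f g : 'rV[R]_n -> \bar R) (mu alpha : R).
Hypotheses (f_proper : efun_proper f) (g_proper : efun_proper g) (mu_gt0 : 0 < mu).
Hypotheses (f_thr : (mu%:E < prox_threshold f)%E) (g_thr : (mu%:E < prox_threshold g)%E).

(** Inside the outer envelope the squares of [u] cancel, and [u = mu *: s] leaves a function of [s]
    that is affine in [x], up to the square of [x]. So the proximal average plus the quadratic is
    the conjugate of the averaged conjugates. *)
Lemma prox_avg_leP x (b : R) :
  (prox_avg mu alpha f g x + ((2 * mu)^-1 * dot x x)%:E <= b%:E)%E <->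
  forall s, dot s x - alpha * moreau_conj f mu s - (1 - alpha) * moreau_conj g mu s <= b.
Proof.
rewrite -leeBrDr // /prox_avg leeNl.
have termE u : (- (alpha%:E * moreau_env mu f u) - (1 - alpha)%:E * moreau_env mu g u +
    ((2 * mu)^-1 * enorm (u - x) ^+ 2)%:E)%E =
    (alpha * moreau_conj f mu (mu^-1 *: u) + (1 - alpha) * moreau_conj g mu (mu^-1 *: u)
     - dot (mu^-1 *: u) x + (2 * mu)^-1 * dot x x)%:E.
  rewrite !moreau_envE // -!EFinM -!EFinN -!EFinD enormE; congr EFin.
  rewrite dotDl !dotDr !dotNl !dotNr dotZl (dotC x u).
  by field; rewrite gt_eqF.
split=> [le_inf s|le_b].
  have : (- (b%:E - ((2 * mu)^-1 * dot x x)%:E) <= (alpha * moreau_conj f mu s +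
      (1 - alpha) * moreau_conj g mu s - dot s x + (2 * mu)^-1 * dot x x)%:E)%E.
    apply: le_trans le_inf _; apply: ereal_inf_lbound; exists (mu *: s) => //.
    by rewrite termE scalerA mulVf ?gt_eqF // scale1r.
  by rewrite -EFinB -EFinN lee_fin; lra.
apply: le_ereal_inf_tmp => _ [u _ <-]; rewrite termE -EFinB -EFinN lee_fin.
have := le_b (mu^-1 *: u); lra.
Qed.

End prox_average.

Theorem theorem8p1 (R : realType) (n : nat) (f g : 'rV[R]_n -> \bar R)
  (mu alpha : R) (x y z : 'rV[R]_n)
  (l m : nat) (ys : 'I_l -> 'rV[R]_n) (zs : 'I_m -> 'rV[R]_n)
  (f_proper : efun_proper f) (f_lsc : lower_semicontinuous f)
  (f_pb : prox_bounded f)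
  (g_proper : efun_proper g) (g_lsc : lower_semicontinuous g)
  (g_pb : prox_bounded g)
  (mu_gt0 : 0 < mu)
  (mu_lt : (mu%:E < Order.min (prox_threshold f) (prox_threshold g))%E)
  (alpha_gt0 : 0 < alpha) (alpha_lt1 : alpha < 1)
  (x_dom : efun_dom (prox_avg mu alpha f g) x)
  (x_yz : x = y + z)
  (cond_a :
     inf_conv (epi_scale alpha (conv_fun (add_quad mu f)))
              (epi_scale (1 - alpha) (conv_fun (add_quad mu g))) x =
     (alpha%:E * conv_fun (add_quad mu f) (alpha^-1 *: y) +
      (1 - alpha)%:E * conv_fun (add_quad mu g) ((1 - alpha)^-1 *: z))%E)
  (cond_b : called_by (add_quad mu f) (alpha^-1 *: y) ys)
  (cond_c : called_by (add_quad mu g) ((1 - alpha)^-1 *: z) zs) :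
  [/\ frechet_subdiff (prox_avg mu alpha f g) x =
        limiting_subdiff (prox_avg mu alpha f g) x,
      limiting_subdiff (prox_avg mu alpha f g) x =
        clarke_subdiff (prox_avg mu alpha f g) x &
      clarke_subdiff (prox_avg mu alpha f g) x =
        [set s - mu^-1 *: x | s in
          (\bigcap_(i in [set: 'I_l]) fenchel_subdiff (add_quad mu f) (ys i))
          `&`
          (\bigcap_(j in [set: 'I_m])
             fenchel_subdiff (add_quad mu g) (zs j))]].
Proof.
subst x; move: mu_lt; rewrite lt_min => /andP[f_thr g_thr].
pose c := (2 * mu)^-1.
pose Phi w := (prox_avg mu alpha f g w + (c * dot w w)%:E)%E.
have Phi_leP : forall w b, _ <-> _ := prox_avg_leP alpha f_proper g_proper mu_gt0 f_thr g_thr.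
have avgE : prox_avg mu alpha f g = (fun w => Phi w - (c * dot w w)%:E)%E.
  by apply/funext => w; rewrite /Phi addeK.
have c_ge0 : 0 <= c by rewrite invr_ge0 mulr_ge0 // ltW.
have PhiNy := averaged_conjugate_gtNy Phi_leP.
have Phi_convex := averaged_conjugate_convex Phi_leP.
have clarkeE := clarke_shifted c_ge0 PhiNy Phi_convex (y + z).
have limitingE := limiting_shifted c_ge0 PhiNy Phi_convex (y + z).
have frechetP := frechet_shifted c_ge0 PhiNy Phi_convex (y + z).
rewrite avgE limitingE clarkeE; split=> //.
have fenchelE : fenchel_subdiff Phi (y + z) = _ := averaged_subdifferential alpha_gt0 alpha_lt1
  (moreau_conjP f_proper mu_gt0 f_thr) (moreau_conjP g_proper mu_gt0 g_thr)
  (add_quad_lsc f_lsc) (add_quad_lsc g_lsc) Phi_leP cond_a cond_b cond_c.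
(* The gradient of the quadratic at [y + z] is therefore the shift in the statement. *)
have c2 : 2 * c = mu^-1 by rewrite /c invfM mulrA divff ?mul1r.
rewrite -fenchelE; apply/seteqP; split=> [v /frechetP vP|_ [s sP <-]].
  by exists (v + (2 * c) *: (y + z)) => //; rewrite c2 addrK.
by apply/frechetP; rewrite c2 subrK.
Qed.
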